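(* Let $\mathbb{K}$ be a field, $n$ odd, and let $G=C_n$ be the cycle on the vertex set $[n]$. Let $S=\mathbb{K}[x_1,\ldots,x_n,y_1,\ldots,y_n]$ and $\mathcal{I}_G=(x_ix_j-y_iy_j : \{i,j\}\in E(G))$. Then $\operatorname{reg}(S/\mathcal{I}_G)=n$.
   Context: $S$ is standard graded. For a finitely generated graded $S$-module $M$, $\operatorname{reg}(M)=\max\{j-i : \beta^S_{i,j}(M)\neq 0\}$, where $\beta^S_{i,j}$ are the graded Betti numbers. *)

(* Defs.v *)
From HB Require Import structures.
From mathcomp Require Import all_boot all_algebra.
From mathcomp Require Import mpoly.
Set Implicit Arguments. Unset Strict Implicit. Unset Printing Implicit Defensive.
Import GRing.Theory.
Local Open Scope ring_scope.

Definition xv (K : fieldType) (n : nat) (i : 'I_n) : {mpoly K[n + n]} :=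
  'X_(lshift n i).
Definition yv (K : fieldType) (n : nat) (i : 'I_n) : {mpoly K[n + n]} :=
  'X_(rshift n i).

Definition cycle_binomial (K : fieldType) (n : nat) (i : 'I_n) : {mpoly K[n + n]} :=
  xv K i * xv K (ordS i) - yv K i * yv K (ordS i).

Definition cycle_ideal (K : fieldType) (n : nat) (p : {mpoly K[n + n]}) : Prop :=
  exists c : 'I_n -> {mpoly K[n + n]}, p = \sum_(i < n) c i * cycle_binomial K i.

(* A (finite) minimal graded free resolution of S/I:
     0 <- S/I <- F_0 <- F_1 <- F_2 <- ...
   with F_i = (+)_{k < r i} S(-(a i k)) (row vectors of length r i),
   and the differential F_{i+1} -> F_i given by right multiplication by the
   matrix D i.  Entry (k,l) of D i is homogeneous of degree
   a (i+1) k - a i l (so the maps are graded of degree 0), all entries lie in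
   the homogeneous maximal ideal (minimality), F_0 = S, and the image of
   F_1 -> F_0 is I. *)
Definition min_graded_free_res (K : fieldType) (m : nat)
  (I : {mpoly K[m]} -> Prop) (r : nat -> nat)
  (a : forall i : nat, 'I_(r i) -> nat)
  (D : forall i : nat, 'M[{mpoly K[m]}]_(r i.+1, r i)) : Prop :=
  [/\ r 0 = 1%N,
      (forall j : 'I_(r 0), a 0%N j = 0%N),
      (exists L : nat, forall i : nat, (L < i)%N -> r i = 0%N),
      (forall p : {mpoly K[m]},
          I p <-> exists w : 'rV_(r 1%N), forall j : 'I_(r 0), (w *m D 0%N) 0 j = p) &
      [/\ (forall i : nat, D i.+1 *m D i = 0),
          (forall (i : nat) (v : 'rV_(r i.+1)), v *m D i = 0 ->
              exists w : 'rV_(r i.+2), v = w *m D i.+1),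
          (forall (i : nat) (k : 'I_(r i.+1)) (l : 'I_(r i)), D i k l != 0 ->
              (a i l <= a i.+1 k)%N /\ D i k l \is (a i.+1 k - a i l)%N.-homog) &
          (forall (i : nat) (k : 'I_(r i.+1)) (l : 'I_(r i)), (D i k l)@_0%MM = 0)]].

(* beta_{i,j}(S/I) = #{k < r i | a i k = j} for a minimal graded free
   resolution; reg(S/I) = max{ j - i : beta_{i,j} != 0 }
   = max{ a i k - i : i, k < r i }.  "reg (S/I) = c" is stated as: a minimal
   graded free resolution exists, and for every one this maximum equals c. *)
Definition reg_quotient_eq (K : fieldType) (m : nat)
  (I : {mpoly K[m]} -> Prop) (c : int) : Prop :=
  (exists r a D, @min_graded_free_res K m I r a D) /\
  (forall r a D, @min_graded_free_res K m I r a D ->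
     (forall (i : nat) (k : 'I_(r i)), (a i k)%:Z - i%:Z <= c) /\
     (exists (i : nat) (k : 'I_(r i)), (a i k)%:Z - i%:Z = c)).

(* Main.v *)
(* The [n] quadrics form a regular sequence, so the Koszul complex, an
   iterated mapping cone, is a minimal resolution of [S/I_G] with
   [F_i = S(-2i)^(n choose i)]; its regularity is [n].  Graded comparison maps
   between two minimal resolutions are invertible modulo the maximal ideal, so
   the shifts do not depend on the resolution.

   Regularity of the sequence.  The path binomial [x_k x_{k+1} - y_k y_{k+1}] is
   linear in fresh variables, and its coefficients [x_k], [y_k] are inductively
   nonzerodivisors modulo the previous binomials [J_k].  The same induction
   shows that [x_k - y_k] and [x_0 - y_0] are nonzerodivisors modulo [J_k].  For
   [n] odd the closing binomial has, for a grading making [J_(n-1)] homogeneous,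
   leading form [- (x_0 - y_0) (x_{n-1} - y_{n-1})]; hence it is a nonzerodivisor
   as well, in every characteristic. *)
Require Import Defs.
From HB Require Import structures.
From mathcomp Require Import all_boot all_algebra.
From mathcomp Require Import mpoly.
From mathcomp Require Import zify ring.
Set Implicit Arguments. Unset Strict Implicit. Unset Printing Implicit Defensive.
Import GRing.Theory.
Local Open Scope ring_scope.

(** * Ideals, nonzerodivisors modulo an ideal, and chains of generators *)

Section Ideals.
Variable R : comNzRingType.
Implicit Types (I : R -> Prop) (f g p q c : R).

Definition is_ideal I :=
  [/\ I 0, forall p q, I p -> I q -> I (p + q) & forall c p, I p -> I (c * p)].

(** For an ideal [I] this is [I + (f)]. *)
Definition adj I f p := exists c, I (p - c * f).

Definition nzd I f := forall g, I (g * f) -> I g.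

Lemma idealN I p : is_ideal I -> I p -> I (- p).
Proof. by case=> _ _ hM hp; rewrite -mulN1r; apply: hM. Qed.

Lemma idealB I p q : is_ideal I -> I p -> I q -> I (p - q).
Proof. by move=> hI hp hq; case: (hI) => _ hD _; apply: hD => //; apply: idealN. Qed.

Lemma ideal_sum I (T : Type) (s : seq T) (P : pred T) (F : T -> R) :
  is_ideal I -> (forall i, P i -> I (F i)) -> I (\sum_(i <- s | P i) F i).
Proof. by case=> h0 hD _ hF; apply: (big_ind I). Qed.

Lemma ideal0 : is_ideal (fun p : R => p = 0).
Proof.
by split=> [//|p q -> ->|c p ->]; rewrite ?addr0 ?mulr0.
Qed.

Lemma adj_ideal I f : is_ideal I -> is_ideal (adj I f).
Proof.
case=> h0 hD hM; split; first by exists 0; rewrite mul0r subr0.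
- move=> p q [a ha] [b hb]; exists (a + b).
  have -> : p + q - (a + b) * f = (p - a * f) + (q - b * f) by ring.
  exact: hD.
- move=> c p [a ha]; exists (c * a).
  have -> : c * p - c * a * f = c * (p - a * f) by ring.
  exact: hM.
Qed.

Lemma nzdM I a b : nzd I a -> nzd I b -> nzd I (a * b).
Proof. by move=> ha hb p; rewrite mulrA => /hb /ha. Qed.

Lemma nzdN I a : is_ideal I -> nzd I a -> nzd I (- a).
Proof. by move=> hI ha p; rewrite mulrN => /(idealN hI); rewrite opprK => /ha. Qed.

(** If [p * g = c * f] modulo [I], then [c * f] lies in [I + (g)], so [c = d * g] modulo [I];
    cancelling [g] puts [p - d * f] in [I]. *)
Lemma nzd_swap I f g : is_ideal I ->
  nzd I g -> nzd (adj I g) f -> nzd (adj I f) g.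
Proof.
move=> hI hg hf p [c hc].
have [d hd] : adj I g c.
  apply: hf; exists p; rewrite -opprB.
  exact: idealN.
exists d; apply: hg.
have -> : (p - d * f) * g = (p * g - c * f) + f * (c - d * g) by ring.
by case: (hI) => _ hD hM; apply: hD => //; apply: hM.
Qed.

Lemma adjC I f g p : adj (adj I f) g p -> adj (adj I g) f p.
Proof.
case=> c [d h]; exists d, c.
by have -> // : p - d * f - c * g = p - c * g - d * f by ring.
Qed.

Fixpoint chain I (s : nat -> R) (k : nat) : R -> Prop :=
  if k is k'.+1 then adj (chain I s k') (s k') else I.

Lemma chain_ideal I s k : is_ideal I -> is_ideal (chain I s k).
Proof. by move=> hI; elim: k => //= k; apply: adj_ideal. Qed.

Lemma chain_adjC I s f k p : chain (adj I f) s k p <-> adj (chain I s k) f p.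
Proof.
elim: k p => //= k IH p; split=> [[c /IH h]|/adjC [c h]].
  by apply: adjC; exists c.
by exists c; apply/IH.
Qed.

Lemma chain0P (s : nat -> R) k p :
  chain (fun q => q = 0) s k p <->
  exists c : nat -> R, p = \sum_(i < k) c i * s i.
Proof.
elim: k p => [|k IH] p /=.
  by split=> [->|[c ->]]; [exists (fun=> 0)|]; rewrite big_ord0.
split=> [[c /IH [d hd]]|[c ->]].
  exists (fun i => if i == k then c else d i).
  rewrite big_ord_recr /= eqxx -[LHS](subrK (c * s k)) hd; congr (_ + _).
  by apply: eq_bigr => i _; rewrite ltn_eqF.
by exists (c k); apply/IH; exists c; rewrite big_ord_recr /= addrK.
Qed.

(** * Nonzerodivisors detected in a polynomial extension *)

Definition coef_in I (q : {poly R}) := forall j, I q`_j.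

Lemma coef_in_horner I (q : {poly R}) e : is_ideal I -> coef_in I q -> I q.[e].
Proof.
move=> hI hq; rewrite horner_coef; apply: ideal_sum => // i _.
by rewrite mulrC; case: (hI) => _ _; apply.
Qed.

(* Descending induction on the coefficients: the top coefficient of [q] is
   multiplied by the nonzerodivisor [a]. *)
Lemma coef_in_nzd I (q : {poly R}) a c k : is_ideal I -> nzd I a ->
  coef_in I (q * ('X^k * (a *: 'X + c%:P))) -> coef_in I q.
Proof.
move=> hI ha hq.
suff h m j : (size q <= j + m)%N -> I q`_j by move=> j; apply: (h (size q)); rewrite leq_addl.
elim: m j => [|m IH] j; first by rewrite addn0 => hj; rewrite nth_default //; case: hI.
move=> hj; apply: ha.
have := hq (k + j.+1)%N.
rewrite mulrCA coefXnM ltnNge leq_addr /= addKn mulrDr -scalerAr coefD coefZ coefMX /= coefMC.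
have hS : I (q`_j.+1 * c).
  by rewrite mulrC; case: (hI) => _ _; apply; apply: IH; rewrite addSnnS.
by move=> h; have := idealB hI h hS; rewrite addrK mulrC.
Qed.

(** That is, [th] carries [I] into the extended ideal [I[T]]. *)
Definition stable (th : R -> {poly R}) I := forall p, I p -> coef_in I (th p).

Lemma stable_adj (th : {rmorphism R -> {poly R}}) I f (q : {poly R}) : is_ideal I ->
  stable th I -> th f = q * f%:P -> stable th (adj I f).
Proof.
move=> hI hs hf p [c hc] j.
exists (th c * q)`_j.
have := hs _ hc j.
by rewrite rmorphB rmorphM hf mulrA coefB coefMC.
Qed.

Lemma stable_chain (th : {rmorphism R -> {poly R}}) I s k : is_ideal I ->
  stable th I -> (forall i, (i < k)%N -> exists q : {poly R}, th (s i) = q * (s i)%:P) ->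
  stable th (chain I s k).
Proof.
move=> hI hs; elim: k => //= k IH hk.
have [q hq] := hk k (ltnSn k).
apply: stable_adj hq; first exact: chain_ideal.
by apply: IH => i /ltnW; apply: hk.
Qed.

Section Theta.
Variables (th : {rmorphism R -> {poly R}}) (e : R).
(** In most uses [th] expands an element in a chosen coordinate and [e] is that coordinate; for the
    closing binomial it is a rescaling, with [e = 1]. *)
Hypothesis the : forall p, (th p).[e] = p.
Variable I : R -> Prop.
Hypotheses (hI : is_ideal I) (hs : stable th I).

(** If [p * f] is in [I], then [th p * th f] has coefficients in [I], hence so has [th p];
    evaluation at [e] returns [p]. *)
Lemma nzd_theta f a c k :
  th f = 'X^k * (a *: 'X + c%:P) -> nzd I a -> nzd I f.
Proof.
move=> hf ha p /hs; rewrite rmorphM hf => /coef_in_nzd h.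
by rewrite -[p]the; apply: coef_in_horner => //; apply: h.
Qed.

Lemma nzd_linear f v a c : th v = 'X -> th a = a%:P -> th c = c%:P ->
  f = a * v + c -> nzd I a -> nzd I f.
Proof.
move=> hv ha hc ->; apply: (nzd_theta (c := c) (k := 0)).
by rewrite rmorphD rmorphM hv ha hc mul1r mul_polyC.
Qed.

Lemma nzd_var v : th v = 'X -> nzd I v.
Proof.
move=> hv; apply: (nzd_linear hv (rmorph1 _) (rmorph0 _)); first by rewrite mul1r addr0.
by move=> p; rewrite mulr1.
Qed.

(** From [g * v = h * f] modulo [I], the constant terms in [v] give [h_0 * c] in [I], hence [h_0] in
    [I]. So [h = h' * v] modulo [I], and [v] cancels from [(g - h' * f) * v]. *)
Lemma nzd_var_adj f v a c : th v = 'X -> th a = a%:P -> th c = c%:P ->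
  f = a * v + c -> nzd I c -> nzd (adj I f) v.
Proof.
move=> hv ha hc hf hcI g [h hi].
have h0 : I (th h)`_0.
  apply: hcI; have := hs hi 0%N.
  rewrite rmorphB !rmorphM hf rmorphD rmorphM hv ha hc mulrDr mulrA.
  rewrite coefB coefD !coefMX /= coefMC sub0r add0r => /(idealN hI).
  by rewrite opprK.
pose h' := (drop_poly 1 (th h)).[v].
have v_e : e = v by rewrite -[RHS]the hv hornerX.
have eh : h = (th h)`_0 + h' * v.
  have := congr1 (horner^~ e) (poly_take_drop 1 (th h)).
  rewrite hornerD hornerM hornerXn expr1 the => {1}<-; rewrite /h' v_e; congr (_ + _).
  by rewrite [take_poly _ _]size1_polyC ?size_take_poly // hornerC coef_take_poly.
exists h'; apply: (nzd_var hv).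
have -> : (g - h' * f) * v = (g * v - h * f) + f * (th h)`_0 by rewrite {1}eh; ring.
by case: (hI) => _ hD hM; apply: hD => //; apply: hM.
Qed.
End Theta.
End Ideals.

(** * Regularity of the sequence of cycle binomials *)

Section Cycle.
Variables (K : fieldType) (N : nat).
Let S := {mpoly K[N.+1 + N.+1]}.
(** Natural indices fit [chain]; those above [N] receive a default value from [inord], whence the
    bounds [i <= N] below. *)
Let x (i : nat) : S := xv K (inord i : 'I_N.+1).
Let y (i : nat) : S := yv K (inord i : 'I_N.+1).

Lemma mpoly_rmorph_id (rho : {rmorphism S -> S}) :
  (forall c, rho c%:MP = c%:MP) ->
  (forall i, (i <= N)%N -> rho (x i) = x i) ->
  (forall i, (i <= N)%N -> rho (y i) = y i) -> forall p, rho p = p.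
Proof.
move=> hc hx hy p.
have hX j : rho 'X_j = 'X_j.
  case: (split_ordP j) => i ->.
    by have := hx i (ltn_ord i); rewrite /x /xv inord_val.
  by have := hy i (ltn_ord i); rewrite /y /yv inord_val.
rewrite [p in RHS]mpolyE [p in LHS]mpolyE rmorph_sum; apply: eq_bigr => m _.
rewrite -!mul_mpolyC rmorphM hc; congr (_ * _).
rewrite mpolyXE_id rmorph_prod; apply: eq_bigr => i _.
by rewrite rmorphXn hX.
Qed.

(** The universal property of the polynomial ring gives [th]; that evaluation at [e] undoes it is
    checked on the variables. *)
Lemma theta_exists (hx hy : nat -> {poly S}) (e : S) :
  (forall i, (i <= N)%N -> (hx i).[e] = x i) ->
  (forall i, (i <= N)%N -> (hy i).[e] = y i) ->
  exists th : {rmorphism S -> {poly S}},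
    [/\ forall p, (th p).[e] = p,
        forall i, (i <= N)%N -> th (x i) = hx i &
        forall i, (i <= N)%N -> th (y i) = hy i].
Proof.
move=> ex ey.
pose C : {rmorphism K -> {poly S}} := (@polyC S) \o (@mpolyC _ K).
pose h (j : 'I_(N.+1 + N.+1)) := match split j with inl i => hx i | inr i => hy i end.
pose th : {rmorphism S -> {poly S}} := mmap C h.
have thx i : (i <= N)%N -> th (x i) = hx i.
  move=> hi; rewrite /th /= mmapX mmap1U /h.
  by rewrite (unsplitK (inl _)) inordK.
have thy i : (i <= N)%N -> th (y i) = hy i.
  move=> hi; rewrite /th /= mmapX mmap1U /h.
  by rewrite (unsplitK (inr _)) inordK.
exists th; split=> // p.
apply: (@mpoly_rmorph_id (horner_eval e \o th)) => [c|i hi|i hi] /=.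
- by rewrite mmapC /= /horner_eval hornerC.
- by rewrite -[mmap _ _ _]/(th _) thx // /horner_eval ex.
- by rewrite -[mmap _ _ _]/(th _) thy // /horner_eval ey.
Qed.

Definition path_binomial (i : nat) : S := x i * x i.+1 - y i * y i.+1.
Local Notation s := path_binomial.

Section Base.
Variable I : S -> Prop.
Hypothesis hI : is_ideal I.
(** The base ideal is abstract because the path argument runs over both the zero ideal and
    [(x_0 - y_0)]. *)
Hypothesis hst : forall th : {rmorphism S -> {poly S}},
  th (x 0%N) = (x 0%N)%:P -> th (y 0%N) = (y 0%N)%:P -> stable th I.

Lemma stable_chain_path (th : {rmorphism S -> {poly S}}) k :
  (forall i, (i <= k)%N -> th (x i) = (x i)%:P) ->
  (forall i, (i <= k)%N -> th (y i) = (y i)%:P) -> stable th (chain I s k).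
Proof.
move=> hx hy; apply: stable_chain => // [|i hi]; first by apply: hst; [apply: hx | apply: hy].
exists 1; rewrite mul1r /s !rmorphB !rmorphM; have hi' := ltnW hi.
by rewrite !hx // !hy.
Qed.

(** Expansions in [x k.+1], in [y k.+1] and in [x k.+1 - y k.+1] all preserve [J], and [s k] is
    linear in each, so the claims reduce to its coefficients. *)
Lemma path_step k : (k < N)%N -> let J := chain I s k in
  nzd J (x k) -> nzd J (y k) ->
  [/\ nzd J (s k), nzd (adj J (s k)) (x k.+1), nzd (adj J (s k)) (y k.+1) &
      nzd J (x k - y k) -> nzd (adj J (s k)) (x k.+1 - y k.+1)].
Proof.
move=> hk J hxk hyk.
have hJ : is_ideal J by apply: chain_ideal.
have hk1 := ltnW hk.
have [thx [thxe thxx thxy]] := @theta_exists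
  (fun i => if i == k.+1 then 'X else (x i)%:P) (fun i => (y i)%:P) (x k.+1)
  ltac:(by move=> i _ /=; case: eqP => [->|_]; rewrite ?hornerX ?hornerC)
  ltac:(by move=> i _ /=; rewrite hornerC).
have [thy [thye thyx thyy]] := @theta_exists
  (fun i => (x i)%:P) (fun i => if i == k.+1 then 'X else (y i)%:P) (y k.+1)
  ltac:(by move=> i _ /=; rewrite hornerC)
  ltac:(by move=> i _ /=; case: eqP => [->|_]; rewrite ?hornerX ?hornerC).
(* Here [y k.+1] is kept and the indeterminate stands for [x k.+1 - y k.+1]. *)
have [tht [thte thtx thty]] := @theta_exists
  (fun i => if i == k.+1 then 'X + (y k.+1)%:P else (x i)%:P) (fun i => (y i)%:P)
  (x k.+1 - y k.+1)
  ltac:(by move=> i _ /=; case: eqP => [->|_]; rewrite ?hornerD ?hornerX !hornerC ?subrK)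
  ltac:(by move=> i _ /=; rewrite hornerC).
have ne i : (i <= k)%N -> (i == k.+1) = false by move=> h; apply/eqP; lia.
have le i : (i <= k)%N -> (i <= N)%N by move=> h; lia.
have sx : stable thx J by apply: stable_chain_path => i hi; rewrite ?thxx ?thxy ?ne ?le.
have sy : stable thy J by apply: stable_chain_path => i hi; rewrite ?thyx ?thyy ?ne ?le.
have st : stable tht J by apply: stable_chain_path => i hi; rewrite ?thtx ?thty ?ne ?le.
have y1 : nzd J (y k.+1) by apply: (nzd_var thye hJ sy); rewrite thyy // eqxx.
have x1 : nzd J (x k.+1) by apply: (nzd_var thxe hJ sx); rewrite thxx // eqxx.
split.
- apply: (nzd_linear thxe hJ sx (v := x k.+1) (a := x k) (c := - (y k * y k.+1))) => //.
  + by rewrite thxx // eqxx.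
  + by rewrite thxx ?ne.
  + by rewrite rmorphN rmorphM !thxy // rmorphN rmorphM.
- apply: (nzd_var_adj thxe hJ sx (a := x k) (c := - (y k * y k.+1))) => //.
  + by rewrite thxx // eqxx.
  + by rewrite thxx ?ne.
  + by rewrite rmorphN rmorphM !thxy // rmorphN rmorphM.
  + by apply: nzdN => //; apply: nzdM.
- apply: (nzd_var_adj thye hJ sy (a := - y k) (c := x k * x k.+1)) => //.
  + by rewrite thyy // eqxx.
  + by rewrite rmorphN thyy ?ne // rmorphN.
  + by rewrite rmorphM !thyx // rmorphM.
  + by rewrite /s; ring.
  + by apply: nzdM.
(* With [t = x k.+1 - y k.+1], one has [s k = x k * t + (x k - y k) * y k.+1]. *)
- move=> htk.
  apply: (nzd_var_adj thte hJ st (a := x k) (c := (x k - y k) * y k.+1)) => //.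
  + by rewrite rmorphB thtx // thty // eqxx addrK.
  + by rewrite thtx ?ne.
  + by rewrite rmorphM rmorphB thtx // !thty // ne // rmorphM rmorphB.
  + by rewrite /s; ring.
  + by apply: nzdM.
Qed.

Lemma path_nzd k : (k <= N)%N -> nzd I (x 0%N) -> nzd I (y 0%N) ->
  nzd (chain I s k) (x k) /\ nzd (chain I s k) (y k).
Proof.
move=> hk hx hy; elim: k hk => // k IH hk.
by have [h1 h2] := IH (ltnW hk); have [] := path_step hk h1 h2.
Qed.

Lemma path_nzd_diff k : (k <= N)%N -> nzd I (x 0%N) -> nzd I (y 0%N) ->
  nzd I (x 0%N - y 0%N) -> nzd (chain I s k) (x k - y k).
Proof.
move=> hk hx hy ht; elim: k hk => // k IH hk.
have [h1 h2] := path_nzd (ltnW hk) hx hy.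
by have [_ _ _] := path_step hk h1 h2; apply; apply: IH; apply: ltnW.
Qed.

Lemma path_regular k : (k < N)%N -> nzd I (x 0%N) -> nzd I (y 0%N) ->
  nzd (chain I s k) (s k).
Proof.
move=> hk hx hy; have [h1 h2] := path_nzd (ltnW hk) hx hy.
by have [] := path_step hk h1 h2.
Qed.
End Base.

Let O : S -> Prop := fun p => p = 0.

Lemma nzd0 (p : S) : p != 0 -> nzd O p.
Proof. by move=> hp q /eqP; rewrite mulf_eq0 (negPf hp) orbF => /eqP. Qed.

Lemma stable0 (th : {rmorphism S -> {poly S}}) : stable th O.
Proof. by move=> p -> j; rewrite rmorph0 coef0. Qed.

Lemma x0_neq0 : x 0%N != 0.
Proof. by rewrite -msupp_eq0 msuppX. Qed.
Lemma y0_neq0 : y 0%N != 0.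
Proof. by rewrite -msupp_eq0 msuppX. Qed.
Lemma xy0_neq0 : x 0%N - y 0%N != 0.
Proof.
apply/eqP => /(congr1 (mcoeff U_(lshift N.+1 (inord 0)))).
rewrite mcoeffB !mcoeffX mcoeff0 eqxx.
rewrite (_ : _ == _ = false) ?subr0; first by move/eqP; rewrite oner_eq0.
apply/eqP => /(congr1 (fun m : 'X_{1..N.+1 + N.+1} => m (lshift N.+1 (inord 0)))).
by rewrite /= !mnm1E eqxx eq_rlshift.
Qed.

(** By [nzd_swap] it suffices that [s k] is a nonzerodivisor once [x_0 - y_0] is adjoined to the
    chain; this is path regularity over the base ideal [(x_0 - y_0)]. *)
Lemma path_nzd_diff0 k : (k <= N)%N -> nzd (chain O s k) (x 0%N - y 0%N).
Proof.
have [thx [thxe thxx thxy]] := @theta_exists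
  (fun i => if i == 0 then 'X else (x i)%:P) (fun i => (y i)%:P) (x 0%N)
  ltac:(by move=> i _ /=; case: eqP => [->|_]; rewrite ?hornerX ?hornerC)
  ltac:(by move=> i _ /=; rewrite hornerC).
have [thy [thye thyx thyy]] := @theta_exists
  (fun i => (x i)%:P) (fun i => if i == 0 then 'X else (y i)%:P) (y 0%N)
  ltac:(by move=> i _ /=; rewrite hornerC)
  ltac:(by move=> i _ /=; case: eqP => [->|_]; rewrite ?hornerX ?hornerC).
have hO := @ideal0 S.
have hx : nzd (adj O (x 0%N - y 0%N)) (x 0%N).
  apply: (nzd_var_adj thxe hO (@stable0 _) (a := 1) (c := - y 0%N)).
  - by rewrite thxx.
  - by rewrite rmorph1.
  - by rewrite rmorphN thxy // rmorphN.
  - by rewrite mul1r.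
  - by apply: nzdN => //; apply: nzd0; apply: y0_neq0.
have hy : nzd (adj O (x 0%N - y 0%N)) (y 0%N).
  apply: (nzd_var_adj thye hO (@stable0 _) (a := -1) (c := x 0%N)).
  - by rewrite thyy.
  - by rewrite rmorphN rmorph1 rmorphN.
  - by rewrite thyx.
  - by rewrite mulN1r addrC.
  - by apply: nzd0; apply: x0_neq0.
elim: k => [_|k IH hk]; first by apply: nzd0; apply: xy0_neq0.
apply: nzd_swap; [exact: chain_ideal | by apply: IH; apply: ltnW |].
move=> p /chain_adjC hp; apply/chain_adjC.
apply: (path_regular _ _ hk) hp => //; first exact: adj_ideal.
move=> th h1 h2; apply: (@stable_adj _ th _ _ 1) => //; first exact: stable0.
by rewrite mul1r rmorphB h1 h2 rmorphB.
Qed.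

(* In the coordinates [z_i, t_i], where [z_i] is [x_i] or [y_i] according to the
   parity of [i] and [t_i] is the difference of the two, the grading with
   [deg z_i = 0], [deg t_i = 1] makes every path binomial homogeneous of degree
   1, whereas the closing binomial has leading form [- t_0 * t_N] because [N]
   is even. *)
Lemma cycle_nzd : ~~ odd N -> nzd (chain O s N) (x 0%N * x N - y 0%N * y N).
Proof.
move=> hN.
(* [th] fixes each [z_i] and multiplies each [t_i = x_i - y_i] by the indeterminate, so it
   multiplies every path binomial by the indeterminate. *)
have [th [the thx thy]] := @theta_exists
  (fun i => if odd i then (y i)%:P + 'X * (x i - y i)%:P else (x i)%:P)
  (fun i => if odd i then (y i)%:P else (x i)%:P - 'X * (x i - y i)%:P) 1
  ltac:(by move=> i _ /=; case: ifP => _; rewrite ?hornerD ?hornerM ?hornerX !hornerC //; ring)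
  ltac:(by move=> i _ /=; case: ifP => _; rewrite ?hornerD ?hornerN ?hornerM ?hornerX !hornerC //; ring).
have hO := @ideal0 S.
have hJ : is_ideal (chain O s N) by apply: chain_ideal.
have sJ : stable th (chain O s N).
  apply: stable_chain => // [|i hi]; first exact: stable0.
  exists 'X; rewrite /s !rmorphB !rmorphM !thx ?thy ?(ltnW hi) //=.
  by case: (odd i) => /=; rewrite !rmorphB; ring.
(* Since [0] and [N] are even, the closing binomial is [z_0 t_N + t_0 z_N - t_0 t_N], with terms of
   degrees 1, 1 and 2. *)
apply: (nzd_theta the hJ sJ (k := 1)
  (a := - ((x 0%N - y 0%N) * (x N - y N)))
  (c := x 0%N * (x N - y N) + (x 0%N - y 0%N) * x N)).
  rewrite rmorphB !rmorphM !thx ?thy // (negPf hN) /=.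
  rewrite -mul_polyC rmorphN rmorphD !rmorphM !rmorphB expr1; ring.
apply: nzdN => //; apply: nzdM; first exact: path_nzd_diff0.
apply: path_nzd_diff => //.
- by move=> th' _ _; apply: stable0.
- by apply: nzd0; apply: x0_neq0.
- by apply: nzd0; apply: y0_neq0.
- by apply: nzd0; apply: xy0_neq0.
Qed.

Definition cycle_seq (i : nat) : S := if i == N then x 0%N * x N - y 0%N * y N else s i.

Lemma chain_eq (I : S -> Prop) (f g : nat -> S) k :
  (forall i, (i < k)%N -> f i = g i) -> forall p, chain I f k p <-> chain I g k p.
Proof.
elim: k => //= k IH h p; rewrite h //.
have {}IH := IH (fun i hi => h i (ltnW hi)).
by split=> -[c hc]; exists c; apply/IH.
Qed.

Lemma cycle_seq_regular k : ~~ odd N -> (k <= N)%N ->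
  nzd (chain O cycle_seq k) (cycle_seq k).
Proof.
move=> hN hk p.
have eqs i : (i < k)%N -> cycle_seq i = s i.
  by move=> hi; rewrite /cycle_seq; case: eqP => // ?; lia.
move=> /(chain_eq _ eqs) hp; apply/(chain_eq _ eqs); move: hp.
rewrite {1}/cycle_seq; case: eqP => [->|hne]; first exact: cycle_nzd.
apply: path_regular; first exact: ideal0.
- by move=> th' _ _; apply: stable0.
- lia.
- by apply: nzd0; apply: x0_neq0.
- by apply: nzd0; apply: y0_neq0.
Qed.

Lemma cycle_seqE (i : 'I_N.+1) : cycle_binomial K i = cycle_seq i.
Proof.
rewrite /cycle_seq /path_binomial /cycle_binomial /x /y.
have ei : inord i = i :> 'I_N.+1 by rewrite inord_val.
case: eqP => hi; last first.
  have -> : ordS i = inord i.+1.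
    have := ltn_ord i => hlt; have {}hlt : (i.+1 < N.+1)%N by lia.
    by apply: val_inj; rewrite /= modn_small // inordK.
  by rewrite ei.
have -> : ordS i = inord 0.
  by apply: val_inj; rewrite /= hi modnn inordK.
have -> : i = inord N by apply: val_inj; rewrite /= hi inordK.
ring.
Qed.

Lemma cycle_idealP (p : S) : cycle_ideal p <-> chain O cycle_seq N.+1 p.
Proof.
split=> [[c ->]|/chain0P [c ->]].
  apply/chain0P; exists (fun i => c (inord i)).
  by apply: eq_bigr => i _; rewrite inord_val cycle_seqE.
by exists (fun i => c i); apply: eq_bigr => i _; rewrite cycle_seqE.
Qed.

Lemma cycle_seq_homog i : cycle_seq i \is 2.-homog.
Proof.
rewrite /cycle_seq /s; case: ifP => _; apply: rpredB;
  apply: (@dhomogM _ _ mdeg 1 _ 1); rewrite dhomogX; apply/eqP; exact: mdeg1.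
Qed.
End Cycle.

(** * Minimal resolutions by iterated mapping cones *)

Section Cone.
Variables (K : fieldType) (m : nat).
Local Notation S := {mpoly K[m]}.
Implicit Types (I : S -> Prop) (f : S).

Definition cone_rank (r : nat -> nat) (i : nat) : nat :=
  if i is j.+1 then (r j.+1 + r j)%N else r 0%N.

(** Mapping cone of multiplication by [f]; the sign on [D j] makes consecutive differentials compose
    to zero. *)
Definition cone_diff (r : nat -> nat) (D : forall i, 'M[S]_(r i.+1, r i)) f (i : nat) :
    'M[S]_(cone_rank r i.+1, cone_rank r i) :=
  match i with
  | 0 => col_mx (D 0%N) f%:M
  | j.+1 => block_mx (D j.+1) 0 f%:M (- D j)
  end.

(** Invariant of the induction on the number of quadrics: with shifts [2i] and last nonzero term at
    [L], the maximum of [2i - i] is [L]. *)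
Definition quadratic_res I (L : nat) :=
  exists r (D : forall i, 'M[S]_(r i.+1, r i)),
    [/\ min_graded_free_res I (fun i _ => i.*2) D, (0 < r L)%N &
        forall i, (L < i)%N -> r i = 0%N].

Lemma ord_eq1 n (h : n = 1%N) (i j : 'I_n) : i = j.
Proof. by move: i j; rewrite h => i j; rewrite !ord1. Qed.

Lemma homog_const0 (p : S) d : (0 < d)%N -> p \is d.-homog -> p@_0%MM = 0.
Proof. by move=> hd /dhomog_nemf_coeff; apply; rewrite mf0 neq_ltn hd. Qed.

Lemma quadratic_res0 I : (forall p, I p <-> p = 0) -> quadratic_res I 0.
Proof.
move=> hI; exists (fun i => if i is 0 then 1%N else 0%N), (fun i => 0).
split=> //; last by case.
split=> //; first by exists 0%N; case.
  move=> p; split=> [/hI ->|[w h]]; first by exists 0 => j; rewrite mul0mx mxE.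
  by apply/hI; rewrite -(h 0) mulmx0 mxE.
split.
- by move=> i; rewrite mul0mx.
- by move=> i v _; exists 0; rewrite mulmx0; apply/rowP => -[].
- by move=> i k l; rewrite mxE eqxx.
- by move=> i k l; rewrite mxE mcoeff0.
Qed.

Lemma quadratic_res_eq I J L : (forall p, I p <-> J p) ->
  quadratic_res J L -> quadratic_res I L.
Proof.
move=> h [r [D [[r0 a0 fin im rest] rL rL0]]]; exists r, D; split=> //.
by split=> // p; split=> [/h /im|/im /h].
Qed.

(** The cone is exact because [f] is a nonzerodivisor modulo [I]. Its entries are again quadrics or
    zero, which gives both the shifts [2i] and minimality. *)
Lemma quadratic_res_adj I L f : is_ideal I -> f \is 2.-homog -> nzd I f ->
  quadratic_res I L -> quadratic_res (adj I f) L.+1.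
Proof.
move=> hI hf hnz [r [D [[r0 a0 fin im [DD ex gr cst]] rL rL0]]].
have [hI0 hID hIM] := hI.
exists (cone_rank r), (cone_diff D f).
(* A cycle [(u, w)] of the cone with [w = z D_i] is a boundary: [u + f z] is killed by [D_i], so it
   equals [t D_{i+1}], and [(t, -z)] maps to [(u, w)]. *)
have lift i (u : 'rV_(r i.+1)) (w : 'rV_(r i)) (z : 'rV_(r i.+1)) :
    u *m D i + f *: w = 0 -> w = z *m D i ->
    exists v, row_mx u w = v *m cone_diff D f i.+1.
  move=> h hw; have : (u + f *: z) *m D i = 0 by rewrite mulmxDl -scalemxAl -hw.
  case/ex => t ht; exists (row_mx t (- z)).
  rewrite /= mul_row_block mul_mx_scalar mulmx0 add0r mulmxN mulNmx opprK -hw -ht.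
  by rewrite scalerN addrK.
have dd i : (i.+1.*2 - i.*2)%N = 2 by rewrite doubleS -addn2 addKn.
have homD i k l : D i k l \is 2.-homog.
  have [->|nz] := eqVneq (D i k l) 0; first exact: dhomog0.
  by have [_] := gr i k l nz; rewrite dd.
have homC i k l : cone_diff D f i k l \is 2.-homog.
  have hs n' (k' l' : 'I_n') : (f%:M k' l' : S) \is 2.-homog.
    by rewrite mxE; case: eqP; rewrite ?mulr1n // mulr0n dhomog0.
  case: i k l => [|i] k l /=.
    by rewrite -[k]splitK; case: (split k) => k'; rewrite ?col_mxEu ?col_mxEd.
  rewrite -[k]splitK -[l]splitK; case: (split k) => k'; case: (split l) => l' /=;
    rewrite ?block_mxEul ?block_mxEur ?block_mxEdl ?block_mxEdr //.
    by rewrite mxE dhomog0.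
  by rewrite mxE dhomogN.
split; last by case=> // i hi; rewrite /= !rL0 // ltnW.
  2: by rewrite /= ltn_addl.
split=> //.
- by exists L.+1; case=> // i hi; rewrite /= !rL0 // ltnW.
- move=> p; split=> [[c /im [w hw]]|[w hw]].
    exists (row_mx w (const_mx c)) => j.
    by rewrite mul_row_col mul_mx_scalar mxE hw !mxE mulrC subrK.
  have j0 : 'I_(r 0%N) by rewrite r0; exact: ord0.
  exists (rsubmx w 0 j0); apply/im; exists (lsubmx w) => j.
  have e : (w *m cone_diff D f 0) 0 j = (lsubmx w *m D 0%N) 0 j + f * rsubmx w 0 j.
    by rewrite -[in LHS](hsubmxK w) [cone_diff _ _ _]/= mul_row_col mul_mx_scalar [LHS]mxE [X in _ + X]mxE.
  rewrite -(hw j) e.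
  rewrite (ord_eq1 r0 j0 j).
  by rewrite mulrC addrK.
split.
- case=> [|i] /=.
    rewrite mul_block_col DD mul0mx addr0 mul_scalar_mx mul_mx_scalar.
    by rewrite scalerN subrr col_mx0.
  rewrite mulmx_block !mulmx0 !mul0mx !mulNmx mulmxN opprK !DD !addr0.
  by rewrite mul_scalar_mx mul_mx_scalar subrr ?add0r block_mx0.
- case=> [|i] v.
    rewrite -[v]hsubmxK [cone_diff _ _ _]/= mul_row_col mul_mx_scalar.
    set u := lsubmx v; set w := rsubmx v => h.
    have j0 : 'I_(r 0%N) by rewrite r0; exact: ord0.
    have jE (j : 'I_(r 0%N)) : j = j0 by apply: ord_eq1.
    (* At the bottom, the cycle condition puts [f * w] in [I]; cancelling [f] makes [w] a
       boundary. *)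
    have /im [z hz] : I (w 0 j0).
      apply: hnz; apply/im; exists (- u) => j; rewrite mulNmx -[u *m _](addrK (f *: w)) h.
      by rewrite sub0r opprK (jE j) mxE mulrC.
    by apply: (lift _ _ _ z) => //; apply/rowP => j; rewrite hz (jE j).
  (* Higher up, [w] is itself a cycle of the given resolution, hence a boundary. *)
  rewrite -[v]hsubmxK [cone_diff _ _ _]/= mul_row_block mul_mx_scalar mulmx0 add0r.
  set u := lsubmx v; set w := rsubmx v.
  rewrite -row_mx0 => /eq_row_mx [h1]; rewrite mulmxN => /eqP; rewrite oppr_eq0 => /eqP h2.
  by have [z hz] := ex _ _ h2; apply: (lift _ _ _ z).
- by move=> i k l _; split; [rewrite leq_double | rewrite dd].
- by move=> i k l; apply: (homog_const0 _ (homC i k l)).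
Qed.
End Cone.

(** * Comparison of minimal graded resolutions *)

Section Comparison.
Variables (K : fieldType) (m : nat).
Local Notation S := {mpoly K[m]}.

(** Degree-[d] component of an element of [S(-s)]; the test guards against truncated subtraction. *)
Definition shifted_part (s d : nat) (p : S) : S :=
  if (s <= d)%N then pihomog mdeg (d - s) p else 0.

Lemma shifted_part_sum s d (T : Type) (r : seq T) (P : pred T) (F : T -> S) :
  shifted_part s d (\sum_(i <- r | P i) F i) =
  \sum_(i <- r | P i) shifted_part s d (F i).
Proof.
rewrite /shifted_part; case: ifP => _; first exact: linear_sum.
by rewrite big1.
Qed.

Lemma shifted_part_homog s d k (p : S) : p \is k.-homog ->
  shifted_part s d p = if (k + s == d)%N then p else 0.
Proof.
move=> hp; rewrite /shifted_part; case: (leqP s d) => hsd.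
  case: eqP => h; first by rewrite pihomog_dE // -h addnK.
  by rewrite (pihomog_ne0 _ hp) //; apply/eqP; lia.
by case: eqP => // ?; lia.
Qed.

Lemma shifted_partM s d e (w q : S) : q \is e.-homog ->
  shifted_part s d (w * q) = shifted_part (e + s) d w * q.
Proof.
move=> hq; rewrite [w](@pihomog_partitionE _ _ mdeg _ _ (leqnn _)).
rewrite mulr_suml !shifted_part_sum mulr_suml; apply: eq_bigr => k _.
have hk := pihomogP mdeg k w.
rewrite (shifted_part_homog _ _ (dhomogM hk hq)) (shifted_part_homog _ _ hk) addnA.
by case: ifP => _; rewrite ?mul0r.
Qed.

Definition graded_mx p q (a : 'I_p -> nat) (b : 'I_q -> nat) (M : 'M[S]_(p, q)) :=
  forall k l, M k l != 0 -> (b l <= a k)%N /\ M k l \is (a k - b l)%N.-homog.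

Lemma graded_mx_shifted p q (a : 'I_p -> nat) (b : 'I_q -> nat) M : graded_mx a b M ->
  forall k l, shifted_part (b l) (a k) (M k l) = M k l.
Proof.
move=> hM k l; have [->|nz] := eqVneq (M k l) 0.
  by rewrite /shifted_part; case: ifP; rewrite ?raddf0.
by have [h1 h2] := hM k l nz; rewrite (shifted_part_homog _ _ h2) subnK ?eqxx.
Qed.

Lemma graded_mxM p q r (a : 'I_p -> nat) (b : 'I_q -> nat) (c : 'I_r -> nat) M N :
  graded_mx a b M -> graded_mx b c N -> graded_mx a c (M *m N).
Proof.
move=> hM hN k l nz.
have hcoef j : M k j * N j l != 0 ->
    (c l <= a k)%N /\ M k j * N j l \is (a k - c l)%N.-homog.
  rewrite mulf_eq0 negb_or => /andP [n1 n2].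
  have [h1 h2] := hM k j n1; have [h3 h4] := hN j l n2.
  split; first exact: leq_trans h3 h1.
  have -> : (a k - c l = (a k - b j) + (b j - c l))%N by lia.
  exact: dhomogM.
split.
  case: leqP => // hlt; case/negP: nz; rewrite mxE big1 // => j _.
  by apply/eqP; apply: contraTT hlt => /hcoef [h _]; rewrite -leqNgt.
rewrite mxE; apply: rpred_sum => j _.
have [->|/hcoef [] //] := eqVneq (M k j * N j l) 0; exact: dhomog0.
Qed.

(** Replace each entry of [W] by its component of the right degree; as [N] and [D] are graded, the
    discarded components contribute nothing to the product. *)
Lemma graded_lift p q r (a : 'I_p -> nat) (b : 'I_q -> nat) (c : 'I_r -> nat)
    (N : 'M[S]_(p, r)) (D : 'M[S]_(q, r)) (W : 'M[S]_(p, q)) :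
  graded_mx a c N -> graded_mx b c D -> N = W *m D ->
  exists2 W' : 'M[S]_(p, q), graded_mx a b W' & N = W' *m D.
Proof.
move=> hN hD hW; exists (\matrix_(k, l) shifted_part (b l) (a k) (W k l)).
  move=> k l; rewrite mxE /shifted_part; case: ifP => [h _|]; last by rewrite eqxx.
  by split=> //; apply: pihomogP.
apply/matrixP => k l; rewrite -(graded_mx_shifted hN) hW !mxE shifted_part_sum.
apply: eq_bigr => j _; rewrite mxE.
have [->|nz] := eqVneq (D j l) 0; first by rewrite !mulr0 /shifted_part; case: ifP; rewrite ?raddf0.
by have [h1 h2] := hD j l nz; rewrite (shifted_partM _ _ _ h2) subnK.
Qed.

Lemma mx_lift p q r (N : 'M[S]_(p, r)) (D : 'M[S]_(q, r)) :
  (forall k, exists w, row k N = w *m D) -> exists W, N = W *m D.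
Proof.
move=> h.
suff [w hw] : exists w : 'I_p -> 'rV[S]_q, forall k, row k N = w k *m D.
  exists (\matrix_k w k); apply/row_matrixP => k.
  by rewrite row_mul rowK.
(* Induction on the number of rows makes the finitely many choices. *)
elim: p N h => [|p IH] N h; first by exists (fun=> 0) => -[].
have [w0 h0] := h 0.
have [w hw] := IH (\matrix_k row (lift 0 k) N) (fun k => ltac:(by rewrite rowK)).
exists (fun k => if unlift 0 k is Some k' then w k' else w0) => k.
by case: unliftP => [k' ->|->] //; rewrite -hw rowK.
Qed.

Variables (I : S -> Prop).
Variables (rF : nat -> nat) (aF : forall i, 'I_(rF i) -> nat)
  (DF : forall i, 'M[S]_(rF i.+1, rF i)).
Variables (rG : nat -> nat) (aG : forall i, 'I_(rG i) -> nat)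
  (DG : forall i, 'M[S]_(rG i.+1, rG i)).
Arguments aF : clear implicits.
Arguments aG : clear implicits.
Hypothesis resF : min_graded_free_res I aF DF.
Hypothesis resG : min_graded_free_res I aG DG.

(* [phi] and [psi] are the level-[i] components of comparison maps between the
   resolutions and [h] that of a homotopy from [psi \o phi] to the identity
   (maps act on row vectors from the right); the clauses are what is needed to
   extend them to level [i + 1]. *)
Lemma comparison i : exists (phi : 'M[S]_(rF i, rG i)) (psi : 'M[S]_(rG i, rF i))
    (h : 'M[S]_(rF i, rF i.+1)),
  [/\ graded_mx (aF i) (aG i) phi,
      exists W, DF i *m phi = W *m DG i,
      exists W, DG i *m psi = W *m DF i,
      DF i *m (1%:M - phi *m psi - h *m DF i) = 0 &
      map_mx (mcoeff 0%MM) (phi *m psi) = 1%:M].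
Proof.
case: resF => rF0 aF0 _ imF [DDF exF grF cF].
case: resG => rG0 aG0 _ imG [DDG exG grG cG].
have mapD r (D : forall i, 'M[S]_(r i.+1, r i)) j :
    (forall i k l, (D i k l)@_0%MM = 0) -> map_mx (mcoeff 0%MM) (D j) = 0.
  by move=> h; apply/matrixP => k l; rewrite !mxE h.
elim: i => [|i [phi [psi [h [gphi [W hW] [W' hW'] hh hc]]]]].
  (* Both ranks are 1, but only propositionally, so the identity of [S] is written as a constant
     matrix. *)
  have e : (const_mx 1 : 'M[S]_(rF 0%N, rG 0%N)) *m const_mx 1 = 1%:M :> 'M[S]_(rF 0%N).
    apply/matrixP => k l; rewrite !mxE (ord_eq1 rF0 k l) eqxx.
    rewrite (eq_bigr (fun=> 1)) => [|j _]; last by rewrite !mxE mulr1.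
    by rewrite sumr_const card_ord rG0.
  have lift0 r1 r2 q1 q2 (D1 : 'M[S]_(r1, r2)) (D2 : 'M[S]_(q1, q2)) : r2 = 1%N -> q2 = 1%N ->
      (forall p, I p <-> exists w : 'rV_r1, forall j : 'I_r2, (w *m D1) 0 j = p) ->
      (forall p, I p <-> exists w : 'rV_q1, forall j : 'I_q2, (w *m D2) 0 j = p) ->
      exists W, D1 *m const_mx 1 = W *m D2.
    move=> e1 e2; move: D1 D2; rewrite e1 e2 => D1 D2 i1 i2.
    apply: mx_lift => k.
    have /i2 [w hw] : I (D1 k 0).
      by apply/i1; exists (delta_mx 0 k) => j; rewrite -rowE mxE (ord1 j).
    by exists w; apply/rowP => j; rewrite hw !mxE big_ord1 mxE mulr1.
  exists (const_mx 1), (const_mx 1), 0; split.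
  - move=> k l _; rewrite aF0 aG0 mxE; split=> //; exact: dhomog1.
  - exact: lift0.
  - exact: lift0.
  - by rewrite e mul0mx subr0 subrr mulmx0.
  - by rewrite e map_mx1.
(* Only [phi] is made graded: its degrees compare the shifts, while [psi] matters only through
   constant terms. *)
have [phi' gphi' hphi] := graded_lift (graded_mxM (grF i) gphi) (grG i) hW.
(* The commuting squares turn the left side into [DF i *m (1%:M - phi *m psi - h *m DF i)]. *)
have e1 : (1%:M - phi' *m W' - DF i *m h) *m DF i = 0.
  rewrite !mulmxBl mul1mx -mulmxA -hW' mulmxA -hphi -!mulmxA.
  by rewrite -{1}[DF i]mulmx1 -!mulmxBr.
have [h' hh'] : exists h', 1%:M - phi' *m W' - DF i *m h = h' *m DF i.+1.
  by apply: mx_lift => k; apply: exF; rewrite -row_mul e1 row0.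
exists phi', W', h'; split=> //.
- apply: mx_lift => k; apply: exG.
  by rewrite -row_mul -mulmxA -hphi mulmxA DDF mul0mx row0.
- apply: mx_lift => k; apply: exF.
  by rewrite -row_mul -mulmxA -hW' mulmxA DDG mul0mx row0.
- by rewrite -hh' opprB addrC subrK mulmxA DDF mul0mx.
(* Minimality makes both homotopy terms vanish modulo the maximal ideal. *)
- have -> : phi' *m W' = 1%:M - DF i *m h - h' *m DF i.+1.
    by rewrite -hh' [X in _ = _ - X]addrAC opprB addrCA subrr addr0.
  rewrite !map_mxB !map_mxM !(mapD _ DF) // mul0mx mulmx0 !subr0.
  exact: map_mx1.
Qed.

(** Since [phi *m psi] is the identity modulo the maximal ideal, row [k] of [phi] has an entry with
    nonzero constant term; being homogeneous, it has degree 0, so the two shifts agree. Which shifts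
    occur is enough to determine the regularity. *)
Lemma shift_unique i (k : 'I_(rF i)) : exists l : 'I_(rG i), aF i k = aG i l.
Proof.
have [phi [psi [h [gphi _ _ _ hc]]]] := comparison i.
have : \sum_l (phi k l)@_0%MM * (psi l k)@_0%MM != 0.
  have /matrixP/(_ k k) := hc; rewrite !mxE eqxx raddf_sum /= => e.
  rewrite (eq_bigr (fun l => (phi k l * psi l k)@_0%MM)) => [|l _]; last by rewrite rmorphM.
  by rewrite e oner_eq0.
move=> hs.
have /existsP [l hl] : [exists l, (phi k l)@_0%MM != 0].
  apply: contraNT hs; rewrite negb_exists => /forallP h0.
  by apply/eqP/big1 => l _; have := h0 l; rewrite negbK => /eqP ->; rewrite mul0r.
exists l.
have [|h1 h2] := gphi k l; first by apply: contraNneq hl => ->; rewrite mcoeff0.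
apply/eqP; rewrite eqn_leq h1 andbT; move: hl; apply: contraNT; rewrite -ltnNge => hlt.
by rewrite (homog_const0 _ h2) // subn_gt0.
Qed.
End Comparison.

Theorem theorem3p4 (K : fieldType) (n : nat) (hodd : odd n) (h3 : (3 <= n)%N) :
  reg_quotient_eq (@cycle_ideal K n) n%:Z.
Proof.
case: n hodd h3 => [|N] // hN _.
have [r [D [res rN0 rN]]] : quadratic_res (@cycle_ideal K N.+1) N.+1.
  have koszul k : (k <= N.+1)%N ->
      quadratic_res (chain (fun p => p = 0) (@cycle_seq K N) k) k.
    elim: k => [_|k IH hk]; first exact: quadratic_res0.
    apply: quadratic_res_adj (IH (ltnW hk)).
    - exact: chain_ideal (@ideal0 _).
    - exact: cycle_seq_homog.
    - exact: cycle_seq_regular.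
  exact: quadratic_res_eq (@cycle_idealP K N) (koszul N.+1 (leqnn _)).
split; first by exists r, (fun i _ => i.*2), D.
move=> r' a' D' res'; split=> [i k|].
  (* The shift is [2i], and the existence of [l] forces [i <= N.+1]. *)
  have [l ->] := shift_unique res' res k.
  have hi : (i <= N.+1)%N.
    by case: leqP => // /rN ri; move: (ltn_ord l); rewrite [X in (_ < X)%N]ri.
  lia.
(* The reverse comparison transports a generator of degree [2n] in position [n] to the arbitrary
   resolution. *)
have [k hk] := shift_unique res res' (Ordinal rN0).
by exists N.+1, k; rewrite -hk; lia.
Qed.
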